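(* Let $k$ be $\mathbb{C}$ or $\overline{\mathbb{Q}}$, and let $\mathcal{C}\subset\mathbb{A}^2$ be the curve $4\sigma_1^3 - 36\sigma_1^2 + 81\sigma_1 + 27\sigma_3 - 54 = 0$ in the coordinates $(\sigma_1,\sigma_3)$. Define a map $\phi: \mathbb{A}^2 \to \mathcal{P}_3$, from the affine plane over $k$ to the moduli space of degree three polynomials, by $$\phi(\sigma_1, \sigma_3) = \begin{cases} \left[\dfrac{(12-2\sigma_1)z^3 + (2\sigma_1^2 - 15\sigma_1 + 18)z^2 + 2\sigma_1\sigma_3 - 3\sigma_3}{-3z^3 + (9 + 3\sigma_1)z^2 - (18\sigma_1 - 27)z + 4\sigma_1^2 -12\sigma_1 + 3\sigma_3 + 9}\right] & (\sigma_1, \sigma_3) \notin \mathcal{C}, \\[2ex] \left[\dfrac{(9\sigma_1 - 27)z^3}{(-5\sigma_1+12)z^3 + (\sigma_1^2 +15\sigma_1 - 45)z^2 + (-9\sigma_3)z - \sigma_1\sigma_3 + 6\sigma_3}\right] & (\sigma_1,\sigma_3) \in \mathcal{C},\ \sigma_1 \neq 3,6,\frac{3}{2}, \\[2ex] [z^3] & (\sigma_1, \sigma_3) = (6, 0), \\ [z^3 + z] & (\sigma_1, \sigma_3) = (3, 1),\\ \left[z^3 + \frac{3}{2}z\right] & (\sigma_1, \sigma_3) = (\frac{3}{2}, 0). \end{cases}$$ The map $\phi$ is a bijection, with inverse given by taking the sigma invariants, i.e. sending a class $[f]$ to $(\sigma_1,\sigma_3)$, the first and third sigma invariants of $f$.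 Further, the representatives displayed in the first two cases are in partial fixed-point multiplier form.
   Context: A rational function of degree $3$ over $k$ is regarded as an endomorphism of $\mathbb{P}^1$. For $\alpha\in\mathrm{PGL}_2(k)$, set $f^\alpha=\alpha^{-1}\circ f\circ\alpha$; $[f]$ denotes the class of $f$ under this conjugation, and $\mathcal{M}_3$ is the set of conjugacy classes of degree $3$ rational maps. $\mathcal{P}_3\subset\mathcal{M}_3$ is the set of classes of degree $3$ polynomials; equivalently, $[f]\in\mathcal{P}_3$ if and only if $f$ has a totally ramified fixed point. The multiplier of $f$ at a fixed point $P$ is $\lambda_P=f'(P)$ (computed after a linear change of variables if $P=\infty$). The sigma invariants $\sigma_i$ of a degree $3$ map $f$ are defined by $\prod_{P\in\mathrm{Fix}(f)}(t-\lambda_P)=\sum_{i=0}^{4}(-1)^i\sigma_i t^{4-i}$, where the product runs over the four fixed points of $f$ in $\mathbb{P}^1(k)$ counted with multiplicity. They depend only on $[f]$. A rational function $f$ is in partial fixed-point multiplier form if either (i) $f$ has two or fewer fixed points and all fixed points are equal to their multipliers, or (ii) $f$ has three or more fixed points and at least three of the fixed points are equal to their multipliers.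
   Formalization: In case (ii) of partial fixed-point multiplier form, ''at least three of the fixed points'' is counted with multiplicity (the number of fixed points in the case split counts distinct points); with distinct points throughout the last claim fails, e.g. at (σ₁,σ₃)=(4,2). *)

(* Defs.v *)
From HB Require Import structures.
From mathcomp Require Import all_boot all_order all_algebra all_field.
From mathcomp Require Import complex.
From mathcomp Require Import boolp classical_sets functions reals.

Set Implicit Arguments.
Unset Strict Implicit.
Unset Printing Implicit Defensive.

Import Order.TTheory GRing.Theory Num.Theory.

Local Open Scope ring_scope.
Local Open Scope classical_set_scope.
Local Open Scope complex_scope.

Notation tofrac := (@FracField.tofrac _).

Definition is_C_or_Qbar (k : closedFieldType) : Prop :=
  (exists (R : realType) (h : {rmorphism k -> R[i]}), bijective h) \/
  (exists h : {rmorphism k -> algC}, bijective h).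

(* k(z) is the field of fractions of {poly k}, and a point of P^1(k) is
   an element of [option k], [None] being the point at infinity. *)
Section RationalFunctions.
Variable k : closedFieldType.
Notation ratfun := {fraction {poly k}}.
Implicit Types (f g : ratfun) (A : 'M[k]_2) (P : option k).

(* The numerator and the denominator of the canonical representative of a
   fraction need not be coprime, hence the division by their gcd. *)
Definition rnum f : {poly k} :=
  \n_(repr f) %/ gcdp \n_(repr f) \d_(repr f).
Definition rden f : {poly k} :=
  \d_(repr f) %/ gcdp \n_(repr f) \d_(repr f).

Definition rdegree f : nat := (maxn (size (rnum f)) (size (rden f))).-1.

(* f(g(z)), for g nonconstant. *)
Definition rcomp f g : ratfun :=
  (map_poly (tofrac \o polyC) (rnum f)).[g]
  / (map_poly (tofrac \o polyC) (rden f)).[g].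

(* Elements of PGL_2(k) are represented by invertible matrices. *)
Definition mobius A : ratfun :=
  tofrac (A 0 0 *: 'X + (A 0 1)%:P) / tofrac (A 1 0 *: 'X + (A 1 1)%:P).

Definition rconj A f : ratfun :=
  rcomp (rcomp (mobius (invmx A)) f) (mobius A).

Definition conj_class f : set ratfun :=
  [set g | exists2 A : 'M[k]_2, A \in unitmx & g = rconj A f].

Definition P3 : set (set ratfun) :=
  [set conj_class f | f in [set tofrac p | p in [set p : {poly k} | size p = 4%N]]].

Definition rderiv_at f (z : k) : k :=
  ((rnum f)^`() * rden f - rnum f * (rden f)^`()).[z] / (rden f).[z] ^+ 2.

(* The matrix of z |-> 1/z. *)
Definition inv_mobius : 'M[k]_2 := \matrix_(i, j) (i != j)%:R.

Definition multiplier f P : k :=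
  if P is Some z then rderiv_at f z else rderiv_at (rconj inv_mobius f) 0.

Definition fix_poly f : {poly k} := rnum f - 'X * rden f.

(* The fixed points of f in P^1(k), each repeated according to its
   multiplicity: the fixed point form of f has degree [rdegree f + 1], its
   dehomogenization is [fix_poly f], and its order of vanishing at infinity
   is the resulting drop of degree. *)
Definition fixpts f : seq (option k) :=
  [seq Some z | z <- sval (closed_field_poly_normal (fix_poly f))]
  ++ nseq ((rdegree f).+2 - size (fix_poly f)) None.

(* The invariants of a cubic f: the product below has degree 4. *)
Definition sigma f (i : nat) : k :=
  (-1) ^+ i * (\prod_(P <- fixpts f) ('X - (multiplier f P)%:P))`_(4 - i).

Definition equals_multiplier f : pred (option k) :=
  fun P => P == Some (multiplier f P).

(* The two cases are distinguished by the number of distinct fixed points,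
   whereas "at least three of the fixed points" is counted with
   multiplicity: [rep_off_curve (4, 2)] has the fixed points 1 (double), 2 and
   5/3, of multipliers 1, 2 and 0. *)
Definition partial_fixed_point_multiplier_form f : Prop :=
  let n := size (undup (fixpts f)) in
  ((n <= 2)%N /\ all (equals_multiplier f) (fixpts f)) \/
  ((3 <= n)%N /\ (3 <= count (equals_multiplier f) (fixpts f))%N).

Definition on_curve (s : k * k) : bool :=
  4 * s.1 ^+ 3 - 36 * s.1 ^+ 2 + 81 * s.1 + 27 * s.2 - 54 == 0.

Definition rep_off_curve (s : k * k) : ratfun :=
  let: (s1, s3) := s in
  tofrac ((12 - 2 * s1) *: 'X^3 + (2 * s1 ^+ 2 - 15 * s1 + 18) *: 'X^2
          + (2 * s1 * s3 - 3 * s3)%:P)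
  / tofrac (- 3 *: 'X^3 + (9 + 3 * s1) *: 'X^2 - (18 * s1 - 27) *: 'X
            + (4 * s1 ^+ 2 - 12 * s1 + 3 * s3 + 9)%:P).

Definition rep_on_curve (s : k * k) : ratfun :=
  let: (s1, s3) := s in
  tofrac ((9 * s1 - 27) *: 'X^3)
  / tofrac ((- 5 * s1 + 12) *: 'X^3 + (s1 ^+ 2 + 15 * s1 - 45) *: 'X^2
            + (- 9 * s3) *: 'X + (- s1 * s3 + 6 * s3)%:P).

(* The value [set0] is a dummy, as the other cases cover the plane; it is not
   an element of [P3]. *)
Definition phi (s : k * k) : set ratfun :=
  if ~~ on_curve s then conj_class (rep_off_curve s)
  else if [&& s.1 != 3, s.1 != 6 & s.1 != 3 / 2] then
    conj_class (rep_on_curve s)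
  else if s == (6, 0) then conj_class (tofrac 'X^3)
  else if s == (3, 1) then conj_class (tofrac ('X^3 + 'X))
  else if s == (3 / 2, 0) then conj_class (tofrac ('X^3 + (3 / 2) *: 'X))
  else set0.

End RationalFunctions.

(* Main.v *)
Require Import Defs.
From mathcomp Require Import all_boot all_order all_algebra all_field.
From mathcomp Require Import boolp classical_sets functions.
From mathcomp Require Import complex reals ring.

Set Implicit Arguments.
Unset Strict Implicit.
Unset Printing Implicit Defensive.

Import GRing.Theory Num.Theory.

Local Open Scope ring_scope.
Local Open Scope classical_set_scope.

(** Every cubic polynomial is conjugate to some z^3 + a z + b, where b is
    determined up to sign by the conjugacy class. If r1, r2, r3 are the finite
    fixed points of this polynomial, so that r1 + r2 + r3 = 0, the multipliers
    are 3 r_i^2 + a and, at infinity, 0; hence sigma_1 = 6 - 3 a and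
    sigma_3 = 4 a^3 - 12 a^2 + 9 a + 27 b^2. So (sigma_1, sigma_3) determines
    (a, b^2), and takes every value. The equation of the curve becomes b = 0.

    The representatives of the first two cases are conjugates of
    z^3 + a z + b by explicit Moebius maps. Off the curve, the map
    M(z) = ((3 - 2 a) z - 3 b) / z sends each r_i to its multiplier
    3 r_i^2 + a. On the curve the fixed points of z^3 + a z are 0 and +c, -c
    with c^2 = 1 - a, and the Moebius map sending infinity, 0 and c to their
    multipliers 0, a and 3 - 2 a yields the other representative; it exists
    unless a is 0, 1 or 3/2, the three remaining values of the map phi.

    All these maps are members of the family [cubic_conj A a b] of conjugates
    of z^3 + a z + b, given by explicit coprime forms. Conjugation acts on the
    family through the product of matrices ([rconj_cubic]), so that a conjugacy
    class is the set of all [cubic_conj A a b] ([conj_class_cubic]). The fixed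
    points of [cubic_conj A a b] are the preimages of those of the polynomial,
    with the same multiplicities ([fixpts_cubic]) and the same multipliers
    ([multiplier_cubic]); the invariants ([sigma_cubic]) and the partial
    fixed-point multiplier form ([partial_form_cubic]) follow. The conjugacies
    with the displayed representatives are polynomial identities
    ([rep_off_curve_cubic], [rep_on_curve_cubic]). *)

Local Notation tofrac := (@FracField.tofrac _).

(** * Evaluation of rational functions at rational functions *)

Section Evaluation.
Variable k : closedFieldType.
Notation ratfun := {fraction {poly k}}.
Implicit Types (f g : ratfun) (N D p : {poly k}) (A : 'M[k]_2).

(** The embedding of the constants k into k(z). *)
Definition fracC : {rmorphism k -> ratfun} := (tofrac \o polyC : k -> ratfun).

Lemma tofrac_polyC c : tofrac c%:P = fracC c.
Proof. by []. Qed.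

(** The value P(g) of a polynomial P over k at a rational function g. *)
Definition ev g p : ratfun := (map_poly fracC p).[g].

Definition nonconst g : Prop := forall c : k, g != fracC c.

Lemma evD g p q : ev g (p + q) = ev g p + ev g q.
Proof. by rewrite /ev rmorphD hornerD. Qed.

Lemma evN g p : ev g (- p) = - ev g p.
Proof. by rewrite /ev rmorphN hornerN. Qed.

Lemma evM g p q : ev g (p * q) = ev g p * ev g q.
Proof. by rewrite /ev rmorphM hornerM. Qed.

Lemma evXn g p n : ev g (p ^+ n) = ev g p ^+ n.
Proof. by rewrite /ev rmorphXn horner_exp. Qed.

Lemma evC g c : ev g c%:P = fracC c.
Proof. by rewrite /ev map_polyC hornerC. Qed.

Lemma evX g : ev g 'X = g.
Proof. by rewrite /ev map_polyX hornerX. Qed.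

Definition evE := (evD, evN, evM, evXn, evC, evX).

Lemma ev_prod g (I : Type) (r : seq I) (F : I -> {poly k}) :
  ev g (\prod_(i <- r) F i) = \prod_(i <- r) ev g (F i).
Proof. by rewrite /ev rmorph_prod horner_prod. Qed.

(** Over an algebraically closed field every nonconstant rational function is
    transcendental: P(g) is a product of factors g - r. *)
Lemma ev_neq0 g p : nonconst g -> p != 0 -> ev g p != 0.
Proof.
move=> ncg p0; have [r ->] := closed_field_poly_normal p.
rewrite -mul_polyC evM evC ev_prod mulf_neq0 //.
  by rewrite fmorph_eq0 lead_coef_eq0.
rewrite prodf_seq_neq0; apply/allP=> z _ /=.
by rewrite !evE subr_eq0 ncg.
Qed.

Lemma tofrac_repr f : f = tofrac \n_(repr f) / tofrac \d_(repr f).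
Proof.
set n := \n_ _; set d := \d_ _.
have d0 : tofrac d != 0 by rewrite tofrac_eq0 denom_ratioP.
apply: (mulIf d0); rewrite mulfVK // -[f in LHS]reprK !piE.
apply/eqP; rewrite piE /= FracField.equivfE.
rewrite /FracField.mulf !numden_Ratio ?oner_eq0 ?mulr1 ?denom_ratioP //.
by rewrite mulrC.
Qed.

Lemma gcd_repr_neq0 f : gcdp \n_(repr f) \d_(repr f) != 0.
Proof. by rewrite gcdp_eq0 negb_and denom_ratioP orbT. Qed.

Lemma rden_neq0 f : rden f != 0.
Proof. by rewrite /rden divpN0 ?gcd_repr_neq0 ?leq_gcdpr ?denom_ratioP. Qed.

Lemma coprime_rnum_rden f : coprimep (rnum f) (rden f).
Proof. by rewrite /rnum /rden coprimep_div_gcd // denom_ratioP orbT. Qed.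

Lemma tofrac_rnum_rden f : f = tofrac (rnum f) / tofrac (rden f).
Proof.
rewrite [LHS]tofrac_repr -[in LHS](divpK (dvdp_gcdl \n_(repr f) \d_(repr f))).
rewrite -[X in _ / tofrac X](divpK (dvdp_gcdr \n_(repr f) \d_(repr f))).
rewrite !rmorphM /= -mulf_div divff ?mulr1 //.
by rewrite tofrac_eq0 gcd_repr_neq0.
Qed.

Lemma cross_rnum_rden N D f : D != 0 -> f = tofrac N / tofrac D ->
  N * rden f = rnum f * D.
Proof.
move=> D0 e; apply/eqP; rewrite -tofrac_eq !rmorphM /=.
by rewrite -eqr_div ?tofrac_eq0 ?rden_neq0 // -e -tofrac_rnum_rden.
Qed.

(** Composition can be computed from any representation of a fraction, as
    long as the inner function is not constant. *)
Lemma rcomp_div N D g : nonconst g -> D != 0 ->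
  rcomp (tofrac N / tofrac D) g = ev g N / ev g D.
Proof.
move=> ncg D0; have := cross_rnum_rden D0 erefl.
set f := _ / _ => e; rewrite /rcomp -/(ev g _) -/(ev g _).
apply/eqP; rewrite eqr_div ?ev_neq0 ?rden_neq0 //.
by rewrite -!evM -e.
Qed.

(** Coprime representatives of a fraction are unique up to a scalar. *)
Lemma rnum_rden_coprime N D f : D != 0 -> coprimep N D ->
    f = tofrac N / tofrac D ->
  exists2 c, c != 0 & rnum f = c *: N /\ rden f = c *: D.
Proof.
move=> D0 cND e; have ee := cross_rnum_rden D0 e.
have cDN : coprimep D N by rewrite coprimep_sym.
have cdn : coprimep (rden f) (rnum f) by rewrite coprimep_sym coprime_rnum_rden.
have DdF : D %| rden f by rewrite -(Gauss_dvdpr _ cDN) ee dvdp_mull.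
have FdD : rden f %| D by rewrite -(Gauss_dvdpr _ cdn) -ee dvdp_mull.
have /eqpfP eq1 : D %= rden f by rewrite /eqp DdF FdD.
have l0 : lead_coef D != 0 by rewrite lead_coef_eq0.
have l1 : lead_coef (rden f) != 0 by rewrite lead_coef_eq0 rden_neq0.
pose c := lead_coef (rden f) / lead_coef D.
have c0 : c != 0 by rewrite mulf_neq0 ?invr_eq0.
have ed : rden f = c *: D.
  by rewrite [in RHS]eq1 scalerA mulf_div [X in _ / X]mulrC divff ?scale1r //
    mulf_neq0.
exists c => //; split=> //; apply: (mulIf D0).
by rewrite -ee ed -!mul_polyC; ring.
Qed.

End Evaluation.

(** * Conjugates of the polynomials z^3 + a z + b *)

(** This identity and the next one are used in k(z); over an abstract field
    their normalization does not unfold the quotient construction of k(z). *)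
Lemma mobius_inv_field (F : fieldType) (al be ga de n d det : F) :
    det != 0 -> d != 0 -> al * d - ga * n != 0 ->
  (de / det * (n / d) + - be / det) / (- ga / det * (n / d) + al / det)
  = (de * n - be * d) / (al * d - ga * n).
Proof. by move=> h1 h2 h3; field; rewrite h1 h2 h3. Qed.

Lemma cubic_subst_field (F : fieldType)
    (a00 a01 a10 a11 b00 b01 b10 b11 a b x y z : F) :
    let P := x ^+ 3 + a * x * y ^+ 2 + b * y ^+ 3 in
    let Q := (x / z) ^+ 3 + a * (x / z) * (y / z) ^+ 2 + b * (y / z) ^+ 3 in
    z != 0 ->
    (a00 * b00 + a01 * b10) * y ^+ 3 - (a10 * b00 + a11 * b10) * P != 0 ->
  (b11 * (a11 * Q - a01 * (y / z) ^+ 3) - b01 * (a00 * (y / z) ^+ 3 - a10 * Q))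
  / (b00 * (a00 * (y / z) ^+ 3 - a10 * Q)
     - b10 * (a11 * Q - a01 * (y / z) ^+ 3))
  = ((a10 * b01 + a11 * b11) * P - (a00 * b01 + a01 * b11) * y ^+ 3)
    / ((a00 * b00 + a01 * b10) * y ^+ 3 - (a10 * b00 + a11 * b10) * P).
Proof.
move=> P Q z0; set d := (X in X != 0) => d0.
have -> : Q = P / z ^+ 3 by rewrite /Q /P; field.
rewrite expr_div_n; set z3 := z ^+ 3; set y3 := y ^+ 3.
have z30 : z3 != 0 by rewrite expf_neq0.
have -> : b00 * (a00 * (y3 / z3) - a10 * (P / z3))
    - b10 * (a11 * (P / z3) - a01 * (y3 / z3)) = d / z3.
  by rewrite /d /y3; field.
have <- : d = (a00 * b00 + a01 * b10) * y3 - (a10 * b00 + a11 * b10) * P by [].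
clearbody z3 d; clearbody y3 P.
by field; rewrite z30 d0.
Qed.

Section Conjugates.
Variable k : closedFieldType.
Notation ratfun := {fraction {poly k}}.
Implicit Types (f g : ratfun) (N D p : {poly k}) (A B : 'M[k]_2) (a b : k).

(** The Moebius map of A is the quotient of the linear forms [mx_num A] and
    [mx_den A]. *)
Definition mx_num A : {poly k} := A 0 0 *: 'X + (A 0 1)%:P.
Definition mx_den A : {poly k} := A 1 0 *: 'X + (A 1 1)%:P.

Lemma mx_numE A : mx_num A = (A 0 0)%:P * 'X + (A 0 1)%:P.
Proof. by rewrite /mx_num mul_polyC. Qed.

Lemma mx_denE A : mx_den A = (A 1 0)%:P * 'X + (A 1 1)%:P.
Proof. by rewrite /mx_den mul_polyC. Qed.

Definition det2 A : k := A 0 0 * A 1 1 - A 0 1 * A 1 0.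

Lemma unitmx2 A : (A \in unitmx) = (det2 A != 0).
Proof.
rewrite unitmxE unitfE (expand_det_row _ 0) !big_ord_recl big_ord0.
rewrite /cofactor !det_mx11 !mxE /= expr0 expr1 /det2 mul1r mulN1r mulrN addr0.
by congr (_ * A _ _ - A _ _ * A _ _ != 0); apply: val_inj.
Qed.

Lemma mulmx2 A B i j : (A *m B) i j = A i 0 * B 0 j + A i 1 * B 1 j.
Proof.
rewrite mxE !big_ord_recl big_ord0 addr0 (_ : lift ord0 ord0 = 1) //.
exact: val_inj.
Qed.

Lemma det2M A B : det2 (A *m B) = det2 A * det2 B.
Proof. by rewrite /det2 !mulmx2; ring. Qed.

(** The matrix with rows (u, v) and (w, t). *)
Definition mat2 (u v w t : k) : 'M[k]_2 :=
  \matrix_(i, j) if i == 0 then if j == 0 then u else v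
                 else if j == 0 then w else t.

Lemma mat2E u v w t : (mat2 u v w t 0 0 = u) * (mat2 u v w t 0 1 = v)
  * (mat2 u v w t 1 0 = w) * (mat2 u v w t 1 1 = t).
Proof. by rewrite !mxE. Qed.

Lemma mat2P A B : A 0 0 = B 0 0 -> A 0 1 = B 0 1 -> A 1 0 = B 1 0 ->
  A 1 1 = B 1 1 -> A = B.
Proof.
have o2 (i : 'I_2) : (i == 0) || (i == 1) by case: i => [[|[|?]]].
move=> e00 e01 e10 e11; apply/matrixP=> i j.
by case/orP: (o2 i) => /eqP->; case/orP: (o2 j) => /eqP->.
Qed.

Lemma invmx2 A : det2 A != 0 -> invmx A =
  mat2 (A 1 1 / det2 A) (- A 0 1 / det2 A) (- A 1 0 / det2 A) (A 0 0 / det2 A).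
Proof.
move=> dA; set B := mat2 _ _ _ _.
have uA : A \in unitmx by rewrite unitmx2.
have e : A *m B = 1%:M.
  by apply: mat2P; rewrite mulmx2 !mat2E !mxE /= /det2; field; exact: dA.
by rewrite -[RHS]mul1mx -(mulVmx uA) -mulmxA e mulmx1.
Qed.

(** The two linear forms of an invertible matrix generate the unit ideal. *)
Lemma mx_bezout A :
  (A 0 0)%:P * mx_den A - (A 1 0)%:P * mx_num A = (det2 A)%:P.
Proof. by rewrite mx_numE mx_denE /det2; ring. Qed.

Lemma mx_den_neq0 A : det2 A != 0 -> mx_den A != 0.
Proof.
move=> dA; apply/eqP=> e.
have e1 : A 1 0 = 0.
  by have := congr1 (fun p => p`_1) e; rewrite mx_denE !coefE /= addr0 mulr1.
have e0 : A 1 1 = 0.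
  by have := congr1 (fun p => p`_0) e; rewrite mx_denE !coefE /= mulr0 add0r.
by move: dA; rewrite /det2 e1 e0 !mulr0 subr0 eqxx.
Qed.

Lemma nonconst_mobius A : det2 A != 0 -> nonconst (mobius A).
Proof.
move=> dA c; rewrite /mobius -/(mx_num A) -/(mx_den A); apply/eqP => e.
have d0 : tofrac (mx_den A) != 0 by rewrite tofrac_eq0 mx_den_neq0.
move/(congr1 (fun x => x * tofrac (mx_den A))): e; rewrite /fracC /= divfK //.
move/eqP; rewrite -rmorphM tofrac_eq mx_numE mx_denE => /eqP e.
have e1 : A 0 0 = c * A 1 0.
  have := congr1 (fun p => p`_1) e.
  by rewrite mulrDr mulrA -!polyCM !coefE /= !addr0 !mulr1.
have e0 : A 0 1 = c * A 1 1.
  have := congr1 (fun p => p`_0) e.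
  by rewrite mulrDr mulrA -!polyCM !coefE /= !mulr0 !add0r.
by move/eqP: dA; apply; rewrite /det2 e1 e0; ring.
Qed.

(** Conjugation acts on numerators and denominators by the adjugate matrix,
    followed by the evaluation at the Moebius map. *)
Lemma rconj_div A N D : det2 A != 0 -> D != 0 ->
    nonconst (tofrac N / tofrac D) ->
  rconj A (tofrac N / tofrac D) =
    ev (mobius A) ((A 1 1)%:P * N - (A 0 1)%:P * D)
    / ev (mobius A) ((A 0 0)%:P * D - (A 1 0)%:P * N).
Proof.
move=> dA D0 nc.
have dI : det2 (invmx A) != 0 by rewrite -unitmx2 unitmx_inv unitmx2.
have D0' : tofrac D != 0 by rewrite tofrac_eq0.
have dA' : fracC k (det2 A) != 0 by rewrite fmorph_eq0.
rewrite /rconj.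
set f := _ / _ in nc *.
have q0 : (A 0 0)%:P * D - (A 1 0)%:P * N != 0.
  apply/eqP => q0.
  have [e|A10] := eqVneq (A 1 0) 0.
    move/eqP: q0; rewrite e mul0r subr0 mulf_eq0 (negPf D0) orbF polyC_eq0.
    by move=> /eqP e'; move: dA; rewrite /det2 e e' mul0r mulr0 subr0 eqxx.
  have eN : N = (A 0 0 / A 1 0)%:P * D.
    have c0 : (A 1 0)%:P != 0 by rewrite polyC_eq0.
    apply: (mulfI c0); rewrite mulrA -polyCM mulrCA mulfV // mulr1.
    by apply/esym/eqP; rewrite -subr_eq0 q0.
  have := nc (A 0 0 / A 1 0).
  by rewrite /f eN tofracM -mulrA (divff D0') mulr1 eqxx.
have -> : rcomp (mobius (invmx A)) f = tofrac ((A 1 1)%:P * N - (A 0 1)%:P * D)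
    / tofrac ((A 0 0)%:P * D - (A 1 0)%:P * N).
  rewrite /mobius -/(mx_num _) -/(mx_den _) rcomp_div ?mx_den_neq0 //.
  rewrite mx_numE mx_denE !evE (invmx2 dA) !mat2E /f.
  rewrite -tofrac_eq0 in q0; move: q0.
  rewrite !tofracB !tofracM !tofrac_polyC !fmorph_div !rmorphN => q0.
  by rewrite (mobius_inv_field _ _ dA' D0' q0).
by rewrite (rcomp_div _ (nonconst_mobius dA) q0).
Qed.

(** The homogenization of X^3 + a X + b. *)
Definition cubic_form a b (x y : {poly k}) : {poly k} :=
  x ^+ 3 + a%:P * x * y ^+ 2 + b%:P * y ^+ 3.

Definition cubic_num A a b : {poly k} :=
  (A 1 1)%:P * cubic_form a b (mx_num A) (mx_den A)
  - (A 0 1)%:P * mx_den A ^+ 3.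

Definition cubic_den A a b : {poly k} :=
  (A 0 0)%:P * mx_den A ^+ 3
  - (A 1 0)%:P * cubic_form a b (mx_num A) (mx_den A).

(** The conjugate of z^3 + a z + b by the Moebius map of A, with the
    denominator of the latter cleared. *)
Definition cubic_conj A a b : ratfun :=
  tofrac (cubic_num A a b) / tofrac (cubic_den A a b).

Lemma coprime_cubic A a b : det2 A != 0 ->
  coprimep (cubic_num A a b) (cubic_den A a b).
Proof.
move=> dA.
have cxy : coprimep (mx_num A) (mx_den A).
  apply/Bezout_coprimepP; exists (- (A 1 0)%:P, (A 0 0)%:P) => /=.
  by rewrite addrC mulNr mx_bezout -size_poly_eq1 size_polyC dA.
have cP : coprimep (cubic_form a b (mx_num A) (mx_den A)) (mx_den A ^+ 3).
  rewrite coprimep_expr // coprimep_sym /cubic_form.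
  rewrite (_ : _ + _ + _ = (a%:P * mx_num A * mx_den A
    + b%:P * mx_den A ^+ 2) * mx_den A + mx_num A ^+ 3); last by ring.
  by rewrite coprimep_addl_mul coprimep_expr // coprimep_sym.
apply/coprimepP => d dn dd.
have dP : d %| cubic_form a b (mx_num A) (mx_den A).
  rewrite -(dvdpZr _ _ dA) -mul_polyC.
  have -> : (det2 A)%:P * cubic_form a b (mx_num A) (mx_den A)
      = (A 0 0)%:P * cubic_num A a b + (A 0 1)%:P * cubic_den A a b.
    by rewrite /cubic_num /cubic_den /det2; ring.
  by rewrite dvdp_add // dvdp_mull.
have dy : d %| mx_den A ^+ 3.
  rewrite -(dvdpZr _ _ dA) -mul_polyC.
  have -> : (det2 A)%:P * mx_den A ^+ 3
      = (A 1 0)%:P * cubic_num A a b + (A 1 1)%:P * cubic_den A a b.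
    by rewrite /cubic_num /cubic_den /det2; ring.
  by rewrite dvdp_add // dvdp_mull.
by move/coprimepP: cP => /(_ d dP dy).
Qed.

Lemma size_cubic p (c3 c2 c1 c0 : k) :
    p = c3%:P * 'X^3 + c2%:P * 'X^2 + c1%:P * 'X + c0%:P ->
  (size p <= 4)%N /\ p`_3 = c3.
Proof.
move=> ->; split; last by rewrite !coefE /= !mulr0 mulr1 !addr0.
by apply/leq_sizeP => -[|[|[|[|j]]]] // _; rewrite !coefE /= !mulr0 !addr0.
Qed.

(** The numerator or the denominator has degree 3: their coefficients of
    degree 3 are obtained by an invertible linear map from those of the cubic
    form and of the cube of [mx_den A], which cannot both vanish. *)
Lemma size_cubic_conj A a b : det2 A != 0 ->
  maxn (size (cubic_num A a b)) (size (cubic_den A a b)) = 4%N.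
Proof.
move=> dA.
pose p3 := A 0 0 ^+ 3 + a * A 0 0 * A 1 0 ^+ 2 + b * A 1 0 ^+ 3.
have [p2 [p1 [p0 eP]]] : exists p2 p1 p0 : k,
    cubic_form a b (mx_num A) (mx_den A)
    = p3%:P * 'X^3 + p2%:P * 'X^2 + p1%:P * 'X + p0%:P.
  exists (3 * A 0 0 ^+ 2 * A 0 1
     + a * (2 * A 0 0 * A 1 0 * A 1 1 + A 0 1 * A 1 0 ^+ 2)
     + b * (3 * A 1 0 ^+ 2 * A 1 1)).
  exists (3 * A 0 0 * A 0 1 ^+ 2
     + a * (A 0 0 * A 1 1 ^+ 2 + 2 * A 0 1 * A 1 0 * A 1 1)
     + b * (3 * A 1 0 * A 1 1 ^+ 2)).
  exists (A 0 1 ^+ 3 + a * A 0 1 * A 1 1 ^+ 2 + b * A 1 1 ^+ 3).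
  by rewrite /cubic_form mx_numE mx_denE /p3; ring.
have ey : mx_den A ^+ 3
     = (A 1 0 ^+ 3)%:P * 'X^3 + (3 * A 1 0 ^+ 2 * A 1 1)%:P * 'X^2
     + (3 * A 1 0 * A 1 1 ^+ 2)%:P * 'X + (A 1 1 ^+ 3)%:P.
  by rewrite mx_denE; ring.
pose y3 := A 1 0 ^+ 3.
have [sn tn] : (size (cubic_num A a b) <= 4)%N /\
    (cubic_num A a b)`_3 = A 1 1 * p3 - A 0 1 * y3.
  apply: (size_cubic (c2 := A 1 1 * p2 - A 0 1 * (3 * A 1 0 ^+ 2 * A 1 1))
    (c1 := A 1 1 * p1 - A 0 1 * (3 * A 1 0 * A 1 1 ^+ 2))
    (c0 := A 1 1 * p0 - A 0 1 * A 1 1 ^+ 3)).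
  by rewrite /cubic_num eP ey /y3; ring.
have [sd td] : (size (cubic_den A a b) <= 4)%N /\
    (cubic_den A a b)`_3 = A 0 0 * y3 - A 1 0 * p3.
  apply: (size_cubic (c2 := A 0 0 * (3 * A 1 0 ^+ 2 * A 1 1) - A 1 0 * p2)
    (c1 := A 0 0 * (3 * A 1 0 * A 1 1 ^+ 2) - A 1 0 * p1)
    (c0 := A 0 0 * A 1 1 ^+ 3 - A 1 0 * p0)).
  by rewrite /cubic_den eP ey /y3; ring.
apply/eqP; rewrite eqn_leq geq_max sn sd /= leqNgt; apply/negP.
rewrite ltnS geq_max.
move=> /andP[/leq_sizeP/(_ 3%N)/(_ isT) + /leq_sizeP/(_ 3%N)/(_ isT)].
rewrite tn td => en ed.
have y30 : det2 A * y3 = 0.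
  rewrite (_ : _ * _ = A 1 0 * (A 1 1 * p3 - A 0 1 * y3)
    + A 1 1 * (A 0 0 * y3 - A 1 0 * p3)).
    by rewrite en ed !mulr0 addr0.
  by rewrite /det2; ring.
have p30 : det2 A * p3 = 0.
  rewrite (_ : _ * _ = A 0 0 * (A 1 1 * p3 - A 0 1 * y3)
    + A 0 1 * (A 0 0 * y3 - A 1 0 * p3)).
    by rewrite en ed !mulr0 addr0.
  by rewrite /det2; ring.
move/eqP: y30; rewrite mulf_eq0 (negPf dA) /= expf_eq0 /= => /eqP A10.
move/eqP: p30; rewrite mulf_eq0 (negPf dA) /p3 A10 /= !expr0n /= !mulr0 !addr0.
rewrite expf_eq0 /= => /eqP A00.
by move: dA; rewrite /det2 A10 A00 mul0r mulr0 subr0 eqxx.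
Qed.

Lemma cubic_den_neq0 A a b : det2 A != 0 -> cubic_den A a b != 0.
Proof.
move=> dA; apply/eqP => e; have := size_cubic_conj a b dA.
have := coprime_cubic a b dA; rewrite e size_poly0 maxn0 coprimep0.
by rewrite -size_poly_eq1 => /eqP->.
Qed.

Lemma nonconst_cubic A a b : det2 A != 0 -> nonconst (cubic_conj A a b).
Proof.
move=> dA c; apply/eqP => e.
have d0 : tofrac (cubic_den A a b) != 0 by rewrite tofrac_eq0 cubic_den_neq0.
move/(congr1 (fun x => x * tofrac (cubic_den A a b))): e.
rewrite /cubic_conj (divfK d0) -tofrac_polyC -tofracM => /eqP.
rewrite tofrac_eq mul_polyC => /eqP e.
have := coprime_cubic a b dA; rewrite e.
have [c0|c0] := eqVneq c 0.
  have := size_cubic_conj a b dA; rewrite e c0 scale0r size_poly0 max0n.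
  by rewrite coprime0p -size_poly_eq1 => ->.
rewrite coprimepZl // coprimepp => /eqP s1.
by have := size_cubic_conj a b dA; rewrite e size_scale // s1.
Qed.

(** Conjugation acts on the family through right multiplication. *)
Lemma rconj_cubic A B a b : det2 A != 0 -> det2 B != 0 ->
  rconj B (cubic_conj A a b) = cubic_conj (A *m B) a b.
Proof.
move=> dA dB.
rewrite {1}/cubic_conj rconj_div ?cubic_den_neq0 //; last exact: nonconst_cubic.
have y0 : tofrac (mx_den B) != 0 by rewrite tofrac_eq0 mx_den_neq0.
have d0 : tofrac (cubic_den (A *m B) a b) != 0.
  by rewrite tofrac_eq0 cubic_den_neq0 // det2M mulf_neq0.
have ex : ev (mobius B) (mx_num A)
    = tofrac (mx_num (A *m B)) / tofrac (mx_den B).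
  rewrite [mx_num A]mx_numE !evE /mobius -/(mx_num B) -/(mx_den B).
  rewrite mulrA -[X in _ + X](mulfK y0) -mulrDl; congr (_ / _).
  rewrite -!tofrac_polyC -!tofracM -tofracD; congr (tofrac _).
  by rewrite !mx_numE mx_denE !mulmx2; ring.
have ey : ev (mobius B) (mx_den A)
    = tofrac (mx_den (A *m B)) / tofrac (mx_den B).
  rewrite [mx_den A]mx_denE !evE /mobius -/(mx_num B) -/(mx_den B).
  rewrite mulrA -[X in _ + X](mulfK y0) -mulrDl; congr (_ / _).
  rewrite -!tofrac_polyC -!tofracM -tofracD; congr (tofrac _).
  by rewrite !mx_numE !mx_denE !mulmx2; ring.
move: d0 ex ey; rewrite /cubic_conj /cubic_num /cubic_den /cubic_form.
generalize (mx_num A) (mx_den A) (mx_num (A *m B)) (mx_den (A *m B)).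
move: y0; generalize (mx_den B) => z z0 x y x' y' d0 ex ey.
rewrite !evE ex ey; move: d0.
rewrite !(tofracD, tofracN, tofracM, tofracXn) !tofrac_polyC !mulmx2.
rewrite !(rmorphD, rmorphM) => d0.
by rewrite (cubic_subst_field _ _ z0 d0).
Qed.

End Conjugates.

(** * Fixed points, multipliers and sigma invariants *)

Section LinearForms.
Variable k : closedFieldType.
Implicit Types (l : k * k) (L : seq (k * k)).

(** The zero in P^1(k) of the linear form u X + v Y. *)
Definition form_zero l : option k :=
  if l.1 == 0 then None else Some (- l.2 / l.1).

(** The dehomogenization of the linear form u X + v Y. *)
Definition form_poly l : {poly k} := l.1%:P * 'X + l.2%:P.

(** The determinant of two linear forms. *)
Definition wedge l l' : k := l.1 * l'.2 - l'.1 * l.2.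

Lemma form_zero_neq l l' : wedge l l' != 0 -> form_zero l != form_zero l'.
Proof.
rewrite /wedge /form_zero.
have [u0|u0] := eqVneq l.1 0; have [u0'|u0'] := eqVneq l'.1 0 => //.
  by move=> /eqP[]; rewrite u0 u0' !mul0r subr0.
move=> /eqP w0; apply/eqP => -[/eqP]; rewrite eqr_div // => /eqP e; apply: w0.
rewrite (_ : _ - _ = - l.2 * l'.1 - - l'.2 * l.1); last by ring.
by rewrite e subrr.
Qed.

Lemma form_polyE l : l != (0, 0) -> exists2 c, c != 0 &
  form_poly l = c *: \prod_(z <- seq_of_opt (form_zero l)) ('X - z%:P).
Proof.
case: l => u v; rewrite /form_poly /form_zero xpair_eqE /=.
have [->|u0] /= := eqVneq u 0.
  by move=> v0; exists v => //; rewrite big_nil mul0r add0r alg_polyC.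
move=> _; exists u => //; rewrite big_seq1 -mul_polyC.
by rewrite mulrBr -polyCM mulrCA mulfV // mulr1 polyCN opprK.
Qed.

Lemma prod_form_poly L : all (fun l => l != (0, 0)) L -> exists2 c, c != 0 &
  \prod_(l <- L) form_poly l = c *: \prod_(z <- pmap form_zero L) ('X - z%:P).
Proof.
elim: L => [|l L IH] /=.
  by exists 1; rewrite ?oner_eq0 // !big_nil scale1r.
move=> /andP[/form_polyE [c c0 e] /IH [d d0 e']]; exists (c * d).
  by rewrite mulf_neq0.
rewrite big_cons e e' -!mul_polyC; case: (form_zero l) => [z|] /=.
  by rewrite big_seq1 big_cons polyCM; ring.
by rewrite big_nil polyCM; ring.
Qed.

Lemma perm_pmap_None L :
  perm_eq (map Some (pmap form_zero L)
           ++ nseq (size L - size (pmap form_zero L)) None)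
          (map form_zero L).
Proof.
elim: L => [|l L IH] //=; case: (form_zero l) => [z|] /=.
  by rewrite perm_cons.
rewrite subSn; last by rewrite size_pmap count_size.
rewrite -cat1s (perm_catCA _ [:: None]) /=.
by rewrite perm_cons.
Qed.

(** The zeros of a product of linear forms, the zeros at infinity being
    recovered from the drop of degree of its dehomogenization. *)
Lemma roots_prod_form (F : {poly k}) L c : c != 0 ->
    all (fun l => l != (0, 0)) L -> F = c *: \prod_(l <- L) form_poly l ->
  perm_eq ([seq Some z | z <- sval (closed_field_poly_normal F)]
           ++ nseq ((size L).+1 - size F) None) (map form_zero L).
Proof.
move=> c0 /prod_form_poly[d d0 ->]; rewrite scalerA => eF.
have cd0 : c * d != 0 by rewrite mulf_neq0.
have sF : size F = (size (pmap form_zero L)).+1.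
  by rewrite eF size_scale // size_prod_XsubC.
have F0 : F != 0 by rewrite -size_poly_gt0 sF.
case: closed_field_poly_normal => r /= er.
have /prod_XsubC_eq rp : \prod_(z <- r) ('X - z%:P)
    = \prod_(z <- pmap form_zero L) ('X - z%:P).
  have l0 : lead_coef F != 0 by rewrite lead_coef_eq0.
  apply: (scalerI l0); rewrite -er [LHS]eF; congr (_ *: _).
  by rewrite eF lead_coefZ (eqP (monic_prod_XsubC _ _ _)) mulr1.
rewrite sF subSS -(permPr (perm_pmap_None L)) perm_cat2r.
exact: perm_map.
Qed.

End LinearForms.

Section FixedPoints.
Variable k : closedFieldType.
Notation ratfun := {fraction {poly k}}.
Implicit Types (f : ratfun) (N D : {poly k}) (A B : 'M[k]_2) (a b : k).
Implicit Types (P : option k).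

Lemma rnum_rden_cubic A a b : det2 A != 0 -> exists2 c, c != 0 &
  rnum (cubic_conj A a b) = c *: cubic_num A a b /\
  rden (cubic_conj A a b) = c *: cubic_den A a b.
Proof.
move=> dA; apply: rnum_rden_coprime => //; first exact: cubic_den_neq0.
exact: coprime_cubic.
Qed.

(** For invertible A, the Wronskian of the numerator and the denominator
    vanishes at the critical points: doubly at the preimage of infinity, and at the preimages
    of the zeros of 3 z^2 + a. *)
Lemma wronskian_cubic A a b :
  (cubic_num A a b)^`() * cubic_den A a b
    - cubic_num A a b * (cubic_den A a b)^`()
  = (det2 A ^+ 2)%:P * mx_den A ^+ 2
    * (3 * mx_num A ^+ 2 + a%:P * mx_den A ^+ 2).
Proof.
have dx : (mx_num A)^`() = (A 0 0)%:P.
  by rewrite derivD derivZ derivX derivC addr0 alg_polyC.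
have dy : (mx_den A)^`() = (A 1 0)%:P.
  by rewrite derivD derivZ derivX derivC addr0 alg_polyC.
rewrite expr2 polyCM -[X in _ * X * _ * _]mx_bezout.
rewrite /cubic_num /cubic_den /cubic_form.
move: dx dy; generalize (mx_num A) (mx_den A) => x y dx dy.
have d2 (p : {poly k}) : (p ^+ 2)^`() = 2 * p * p^`() by rewrite expr2 derivM; ring.
have d3 (p : {poly k}) : (p ^+ 3)^`() = 3 * p ^+ 2 * p^`().
  by rewrite exprS derivM d2; ring.
rewrite !(derivB, derivD, derivM, derivC, d2, d3) dx dy /det2.
by ring.
Qed.

Lemma rderiv_at_cubic A a b z : det2 A != 0 ->
  let x := A 0 0 * z + A 0 1 in let y := A 1 0 * z + A 1 1 in
  rderiv_at (cubic_conj A a b) z =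
    det2 A ^+ 2 * y ^+ 2 * (3 * x ^+ 2 + a * y ^+ 2)
    / (A 0 0 * y ^+ 3 - A 1 0 * (x ^+ 3 + a * x * y ^+ 2 + b * y ^+ 3)) ^+ 2.
Proof.
move=> dA x y; have [c c0 [en ed]] := rnum_rden_cubic a b dA.
have ex : (mx_num A).[z] = x by rewrite mx_numE !hornerE.
have ey : (mx_den A).[z] = y by rewrite mx_denE !hornerE.
have eD : (cubic_den A a b).[z]
    = A 0 0 * y ^+ 3 - A 1 0 * (x ^+ 3 + a * x * y ^+ 2 + b * y ^+ 3).
  rewrite /cubic_den /cubic_form; move: ex ey.
  generalize (mx_num A) (mx_den A) => X Y <- <-.
  by rewrite !(hornerD, hornerN, hornerM, horner_exp, hornerC).
rewrite /rderiv_at en ed !derivZ -!scalerAl -!scalerAr !scalerA -scalerBr.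
rewrite wronskian_cubic !hornerZ eD; move: ex ey.
generalize (mx_num A) (mx_den A) => X Y <- <-.
rewrite !(hornerD, hornerN, hornerM, horner_exp, hornerC).
by rewrite exprMn -expr2 -mulf_div divff ?expf_neq0 // mul1r.
Qed.

(** The linear form vanishing at the preimage of a point of P^1(k) under the
    Moebius map of A. *)
Definition pre_form A P : k * k :=
  if P is Some r then (A 0 0 - r * A 1 0, A 0 1 - r * A 1 1)
  else (A 1 0, A 1 1).

Lemma pre_form_neq0 A P : det2 A != 0 -> pre_form A P != (0, 0).
Proof.
move=> dA; apply/eqP; case: P => [r|] /= [e0 e1]; move/eqP: dA; apply.
  rewrite (_ : det2 A = (A 0 0 - r * A 1 0) * A 1 1
    - (A 0 1 - r * A 1 1) * A 1 0).
    by rewrite e0 e1 !mul0r subr0.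
  by rewrite /det2; ring.
by rewrite /det2 e0 e1 !mulr0 subr0.
Qed.

Lemma form_zero_pre_form_neq A P P' : det2 A != 0 -> P != P' ->
  form_zero (pre_form A P) != form_zero (pre_form A P').
Proof.
move=> dA PP'; apply: form_zero_neq; rewrite /wedge.
case: P P' PP' => [r|] [r'|] //= rr'.
- rewrite (_ : _ - _ = det2 A * (r - r')); last by rewrite /det2; ring.
  by rewrite mulf_neq0 // subr_eq0; apply: contraNneq rr' => ->.
- by rewrite (_ : _ - _ = det2 A) //; rewrite /det2; ring.
- by rewrite (_ : _ - _ = - det2 A) ?oppr_eq0 //; rewrite /det2; ring.
Qed.

(** The multipliers of z^3 + a z + b, which has a superattracting fixed point
    at infinity. *)
Definition cubic_mult a P : k := if P is Some r then 3 * r ^+ 2 + a else 0.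

(** P is a fixed point of z^3 + a z + b. *)
Definition fixed_by a b P : Prop :=
  if P is Some r then r ^+ 3 + a * r + b = r else True.

Lemma rderiv_at_fixed A a b P z : det2 A != 0 -> fixed_by a b P ->
    (pre_form A P).1 * z + (pre_form A P).2 = 0 ->
  rderiv_at (cubic_conj A a b) z = cubic_mult a P.
Proof.
move=> dA; rewrite rderiv_at_cubic //.
case: P => [r|] /=.
  move=> er ez.
  have exy : A 0 0 * z + A 0 1 = r * (A 1 0 * z + A 1 1).
    by apply/eqP; rewrite -subr_eq0 -ez; apply/eqP; ring.
  set y := A 1 0 * z + A 1 1 in exy *.
  have ed : det2 A = (A 0 0 - r * A 1 0) * y.
    rewrite (_ : det2 A = (A 0 0 - r * A 1 0) * y
      - A 1 0 * ((A 0 0 - r * A 1 0) * z + (A 0 1 - r * A 1 1))).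
      by rewrite ez mulr0 subr0.
    by rewrite /det2 /y; ring.
  move: dA; rewrite ed mulf_eq0 negb_or => /andP[u0 y0]; rewrite exy.
  rewrite (_ : (r * y) ^+ 3 + _ + _ = (r ^+ 3 + a * r + b) * y ^+ 3); last by ring.
  rewrite er (_ : A 0 0 * y ^+ 3 - _ = (A 0 0 - r * A 1 0) * y ^+ 3); last first.
    by ring.
  move: u0 y0; generalize (A 0 0 - r * A 1 0) y => u w u0 w0.
  by field; rewrite u0 w0.
by move=> _ ->; rewrite expr0n /= mulr0 !mul0r.
Qed.

(** The multiplier at a fixed point is invariant under conjugation. *)
Lemma multiplier_cubic A a b P : det2 A != 0 -> fixed_by a b P ->
  multiplier (cubic_conj A a b) (form_zero (pre_form A P)) = cubic_mult a P.
Proof.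
move=> dA fP; rewrite /form_zero; case: eqVneq => [u0|u0] /=; last first.
  by apply: rderiv_at_fixed => //; rewrite mulrC divfK // addNr.
(* At infinity, the multiplier is by definition a derivative at 0 of the
   conjugate by z |-> 1/z, which belongs to the same family. *)
have jE i j : inv_mobius k i j = (i != j)%:R by rewrite mxE.
have dJ : det2 (inv_mobius k) != 0.
  by rewrite /det2 !jE /= !(mul0r, mulr0, mul1r) sub0r oppr_eq0 oner_eq0.
rewrite rconj_cubic //; apply: rderiv_at_fixed => //.
  by rewrite det2M mulf_neq0.
rewrite mulr0 add0r -[RHS]u0; case: P {fP u0} => [r|] /=.
  by rewrite !mulmx2 !jE /= !(mulr0, mulr1, addr0, add0r).
by rewrite !mulmx2 !jE /= !(mulr0, mulr1, addr0, add0r).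
Qed.

(** The coefficients a and b of the cubic z^3 + a z + b whose finite fixed
    points are r1, r2 and - (r1 + r2). *)
Definition coef_a (r1 r2 : k) : k := 1 + r1 * r2 - (r1 + r2) ^+ 2.
Definition coef_b (r1 r2 : k) : k := r1 * r2 * (r1 + r2).
Definition cubic_fixpts (r1 r2 : k) : seq (option k) :=
  [:: None; Some r1; Some r2; Some (- (r1 + r2))].

Lemma cubic_fixpts_fixed r1 r2 P :
  P \in cubic_fixpts r1 r2 -> fixed_by (coef_a r1 r2) (coef_b r1 r2) P.
Proof.
by rewrite !inE => /or4P[]/eqP-> //=; rewrite /coef_a /coef_b; ring.
Qed.

Lemma fixpts_cubic A r1 r2 : det2 A != 0 ->
  perm_eq (fixpts (cubic_conj A (coef_a r1 r2) (coef_b r1 r2)))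
          [seq form_zero (pre_form A P) | P <- cubic_fixpts r1 r2].
Proof.
set a := coef_a _ _; set b := coef_b _ _ => dA.
have [c c0 [en ed]] := rnum_rden_cubic a b dA.
have dg : rdegree (cubic_conj A a b) = 3%N.
  by rewrite /rdegree en ed !size_scale // size_cubic_conj.
rewrite /fixpts dg (map_comp (@form_zero k)).
apply: (@roots_prod_form _ _ [seq pre_form A P | P <- cubic_fixpts r1 r2] c) => //.
  by apply/allP => l /mapP[P _ ->]; rewrite pre_form_neq0.
(* With x and y the two forms of A, the fixed point polynomial is, up to a
   scalar, y times the product of the x - r_i y. *)
rewrite /fix_poly en ed -scalerAr -scalerBr; congr (_ *: _).
rewrite /= !big_cons big_nil mulr1 /cubic_num /cubic_den /cubic_form.
by rewrite mx_numE mx_denE /form_poly /= /a /b /coef_a /coef_b; ring.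
Qed.

Lemma sigma_cubic_fixpts A r1 r2 i : det2 A != 0 ->
  let a := coef_a r1 r2 in
  sigma (cubic_conj A a (coef_b r1 r2)) i =
  (-1) ^+ i *
    (\prod_(P <- cubic_fixpts r1 r2) ('X - (cubic_mult a P)%:P))`_(4 - i).
Proof.
move=> dA a; rewrite /sigma (perm_big _ (fixpts_cubic r1 r2 dA)) big_map.
congr (_ * (polyseq _)`_ _); apply: eq_big_seq => P /cubic_fixpts_fixed fP.
by rewrite multiplier_cubic.
Qed.

(** The first and third sigma invariants of z^3 + a z + b. *)
Definition cubic_sigma a b : k * k :=
  (6 - 3 * a, 4 * a ^+ 3 - 12 * a ^+ 2 + 9 * a + 27 * b ^+ 2).

Lemma cubic_fixpts_exist a b :
  exists r1 r2, a = coef_a r1 r2 /\ b = coef_b r1 r2.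
Proof.
pose p : {poly k} := 1%:P * 'X^3 + 0%:P * 'X^2 + (a - 1)%:P * 'X + b%:P.
have [sp p3] := size_cubic (erefl p).
have sp4 : size p = 4%N.
  apply/eqP; rewrite eqn_leq sp /= ltnNge; apply/negP.
  by move=> /leq_sizeP/(_ 3%N (leqnn _))/eqP; rewrite p3 oner_eq0.
have [r er] := closed_field_poly_normal p.
have lp : lead_coef p = 1 by rewrite /lead_coef sp4.
rewrite lp scale1r in er.
have := sp4; rewrite er size_prod_XsubC => -[].
case: r er => [|r1 [|r2 [|r3 [|]]]] //; rewrite !big_cons big_nil mulr1 => er _.
have er' : p = 1%:P * 'X^3 + (- (r1 + r2 + r3))%:P * 'X^2
   + (r1 * r2 + r2 * r3 + r3 * r1)%:P * 'X + (- (r1 * r2 * r3))%:P.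
  by rewrite er; ring.
have e2 : p`_2 = 0 by rewrite !coefE /= !(mulr0, mul0r, addr0, add0r).
have e1 : p`_1 = a - 1.
  by rewrite !coefE /= !(mulr0, mulr1, mul0r, addr0, add0r).
have e0 : p`_0 = b by rewrite !coefE /= !(mulr0, mul0r, addr0, add0r).
move: e2 e1 e0; rewrite er' !coefE /= !(mulr0, mulr1, mul0r, addr0, add0r).
move/eqP; rewrite oppr_eq0 addr_eq0 => /eqP e2 e1 e0.
have {}e2 : r3 = - (r1 + r2) by rewrite e2 opprK.
exists r1, r2; split.
  by rewrite /coef_a -[a](subrK 1) -e1 e2; ring.
by rewrite -e0 /coef_b e2; ring.
Qed.

Lemma sigma_cubic A a b : det2 A != 0 ->
  (sigma (cubic_conj A a b) 1, sigma (cubic_conj A a b) 3) = cubic_sigma a b.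
Proof.
move=> dA; have [r1 [r2 [-> ->]]] := cubic_fixpts_exist a b.
set a' := coef_a r1 r2.
rewrite !sigma_cubic_fixpts // !big_cons big_nil mulr1 -/a' /=.
set m1 := 3 * r1 ^+ 2 + a'; set m2 := 3 * r2 ^+ 2 + a'.
set m3 := 3 * (- (r1 + r2)) ^+ 2 + a'.
set p : {poly k} := ('X - 0%:P) * _.
have ep : p = 1%:P * 'X^4 + (- (m1 + m2 + m3))%:P * 'X^3
   + (m1 * m2 + m2 * m3 + m3 * m1)%:P * 'X^2 + (- (m1 * m2 * m3))%:P * 'X.
  by rewrite /p; ring.
have p3 : p`_3 = - (m1 + m2 + m3).
  by rewrite ep !coefE /= !(mulr0, mulr1, mul0r, addr0, add0r).
have p1 : p`_1 = - (m1 * m2 * m3).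
  by rewrite ep !coefE /= !(mulr0, mulr1, mul0r, addr0, add0r).
rewrite p3 p1; congr pair.
  by rewrite /m1 /m2 /m3 /a' /coef_a; ring.
by rewrite /m1 /m2 /m3 /a' /coef_a /coef_b; ring.
Qed.

End FixedPoints.

(** * Conjugacy classes and the displayed representatives *)

Section Classes.
Variable k : closedFieldType.
Notation ratfun := {fraction {poly k}}.
Implicit Types (f g : ratfun) (N D p : {poly k}) (A B : 'M[k]_2) (a b : k).

(** The set of all conjugates of z^3 + a z + b. *)
Definition cubic_class a b : set ratfun :=
  [set g | exists2 A, det2 A != 0 & g = cubic_conj A a b].

Lemma conj_class_cubic A a b : det2 A != 0 ->
  conj_class (cubic_conj A a b) = cubic_class a b.
Proof.
move=> dA; apply/seteqP; split=> g /=.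
  move=> [B]; rewrite unitmx2 => dB ->; rewrite rconj_cubic //.
  by exists (A *m B) => //; rewrite det2M mulf_neq0.
move=> [B dB ->]; have uA : A \in unitmx by rewrite unitmx2.
exists (invmx A *m B); first by rewrite unitmx_mul unitmx_inv uA unitmx2.
rewrite rconj_cubic // ?mulmxA ?mulmxV ?mul1mx //.
by rewrite -unitmx2 unitmx_mul unitmx_inv uA unitmx2.
Qed.

Lemma tofrac_div_scale c N D N' D' : c != 0 -> N = c *: N' -> D = c *: D' ->
  tofrac N / tofrac D = tofrac N' / tofrac D'.
Proof.
move=> c0 -> ->; rewrite -!mul_polyC !tofracM tofrac_polyC -mulf_div divff ?mul1r //.
by rewrite fmorph_eq0.
Qed.

Lemma det2_mat u v w t : det2 (mat2 u v w t) = u * t - v * w :> k.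
Proof. by rewrite /det2 !mat2E. Qed.

Lemma tofrac_cubic_conj u v p a b : u != 0 ->
    u%:P * p = (u%:P * 'X + v%:P) ^+ 3 + a%:P * (u%:P * 'X + v%:P) + b%:P - v%:P ->
  tofrac p = cubic_conj (mat2 u v 0 1) a b.
Proof.
move=> u0 ep; rewrite -[LHS]divr1 -tofrac1 /cubic_conj; apply/esym.
apply: (tofrac_div_scale u0); rewrite -mul_polyC.
  by rewrite ep /cubic_num /cubic_form mx_numE mx_denE !mat2E; ring.
by rewrite /cubic_den /cubic_form mx_numE mx_denE !mat2E; ring.
Qed.

Lemma sqrt_exists (c : k) : exists u, u ^+ 2 = c.
Proof.
have /closed_rootP[u] : size ('X^2 - c%:P : {poly k}) != 1%N by rewrite size_XnsubC.
by rewrite /root !hornerE subr_eq0 => /eqP <-; exists u; rewrite expr2.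
Qed.

(** An affine change of variable brings a cubic polynomial to the form
    z^3 + a z + b. *)
Lemma conj_class_poly p : 3 != 0 :> k -> size p = 4%N -> exists a b,
  conj_class (tofrac p) = cubic_class a b.
Proof.
move=> n3 sp.
have c30 : p`_3 != 0.
  by have := lead_coef_eq0 p; rewrite /lead_coef sp -size_poly_eq0 sp /= => ->.
(* The conjugating map is z |-> u z + v: u^2 is the leading coefficient, and
   v cancels the quadratic term. *)
have [u eu] := sqrt_exists p`_3.
have u0 : u != 0 by apply: contraNneq c30 => u0; rewrite -eu u0 expr0n.
pose v := p`_2 / (3 * u); pose a := p`_1 - 3 * v ^+ 2.
pose b := u * p`_0 - v ^+ 3 - a * v + v.
have ep : p = (p`_3)%:P * 'X^3 + (p`_2)%:P * 'X^2 + (p`_1)%:P * 'X + (p`_0)%:P.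
  apply/polyP => -[|[|[|[|i]]]];
    rewrite !coefE /= ?(mulr0, mulr1, addr0, add0r) //.
  by rewrite nth_default // sp.
have e2 : p`_2 = 3 * u * v by rewrite mulrC divfK // mulf_neq0.
have dA : det2 (mat2 u v 0 1) != 0 by rewrite det2_mat mulr0 subr0 mulr1.
exists a, b; rewrite -(conj_class_cubic a b dA); congr conj_class.
apply: tofrac_cubic_conj => //; rewrite [p]ep -eu e2.
by rewrite (_ : b = u * p`_0 - v ^+ 3 - a * v + v) // /a; ring.
Qed.

Lemma on_curve_cubic a b : 3 != 0 :> k -> on_curve (cubic_sigma a b) = (b == 0).
Proof.
move=> n3; rewrite /on_curve /cubic_sigma /=.
rewrite (_ : _ - 54 = 3 ^+ 6 * b ^+ 2); last by ring.
by rewrite mulf_eq0 !expf_eq0 /= (negPf n3).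
Qed.

Lemma cubic_sigma_onto s : 3 != 0 :> k -> exists a b, s = cubic_sigma a b.
Proof.
move=> n3; case: s => s1 s3; pose a := (6 - s1) / 3.
have [b eb] := sqrt_exists ((s3 - (4 * a ^+ 3 - 12 * a ^+ 2 + 9 * a)) / 3 ^+ 3).
exists a, b; rewrite /cubic_sigma eb; congr pair.
  by rewrite /a; field.
have -> : 27 = 3 ^+ 3 :> k by ring.
by rewrite [3 ^+ 3 * _]mulrC divfK ?expf_neq0 // addrC subrK.
Qed.

(** The adjugate of the matrix of z |-> ((3 - 2 a) z - 3 b) / z, which maps
    the finite fixed points of z^3 + a z + b to their multipliers. *)
Definition off_mx a b : 'M[k]_2 := mat2 0 (3 * b) (-1) (3 - 2 * a).

Lemma rep_off_curve_cubic a b : b != 0 -> 3 != 0 :> k ->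
  rep_off_curve (cubic_sigma a b) = cubic_conj (off_mx a b) a b.
Proof.
move=> b0 n3; have c0 : 3 / b != 0 by rewrite mulf_neq0 ?invr_neq0.
have scaled N N' : b%:P * N = 3 * N' -> N = (3 / b) *: N'.
  move=> e; have b0' : b%:P != 0 by rewrite polyC_eq0.
  apply: (mulfI b0'); rewrite e -mul_polyC mulrA -polyCM [b * _]mulrC divfK //.
  by rewrite -polyC_natr.
rewrite /rep_off_curve /cubic_sigma; apply: (tofrac_div_scale c0); apply: scaled.
  by rewrite /cubic_num /cubic_form mx_numE mx_denE !mat2E -!mul_polyC; ring.
by rewrite /cubic_den /cubic_form mx_numE mx_denE !mat2E -!mul_polyC; ring.
Qed.

(** For a = 1 - c^2, the matrix of a map whose inverse sends the fixed points
    infinity, 0 and c of z^3 + a z to their multipliers 0, a and 3 - 2 a. *)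
Definition on_mx (c : k) : 'M[k]_2 :=
  let a := 1 - c ^+ 2 in mat2 (3 - 2 * a) (- a * (3 - 2 * a)) (3 * c) 0.

Lemma rep_on_curve_cubic c : let a := 1 - c ^+ 2 in
    a != 0 -> c != 0 -> 3 - 2 * a != 0 ->
  rep_on_curve (cubic_sigma a 0) = cubic_conj (on_mx c) a 0.
Proof.
move=> a a0 c0 a3; rewrite /rep_on_curve /cubic_sigma /cubic_conj; apply/esym.
have d0 : c * a * (3 - 2 * a) != 0 by rewrite !mulf_neq0.
apply: (tofrac_div_scale d0); rewrite -!mul_polyC.
  by rewrite /cubic_num /cubic_form mx_numE mx_denE !mat2E /a; ring.
by rewrite /cubic_den /cubic_form mx_numE mx_denE !mat2E /a; ring.
Qed.

End Classes.

(** * The map phi and the partial fixed-point multiplier form *)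

Section Plane.
Variable k : closedFieldType.
Hypothesis (n2 : 2 != 0 :> k) (n3 : 3 != 0 :> k).
Implicit Types (A : 'M[k]_2) (a b c : k) (s : k * k).

Lemma sigma1_neq6 a : (6 - 3 * a != 6) = (a != 0).
Proof.
rewrite -subr_eq0 (_ : _ - 6 = - (3 * a)); last by ring.
by rewrite oppr_eq0 mulf_eq0 (negPf n3).
Qed.

Lemma sigma1_neq3 a : (6 - 3 * a != 3) = (a != 1).
Proof.
rewrite -subr_eq0 (_ : _ - 3 = - (3 * (a - 1))); last by ring.
by rewrite oppr_eq0 mulf_eq0 (negPf n3) subr_eq0.
Qed.

Lemma sigma1_neq3half a : (6 - 3 * a != 3 / 2) = (a != 3 / 2).
Proof.
rewrite -subr_eq0 (_ : _ - 3 / 2 = - (3 * (a - 3 / 2))); last by field.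
by rewrite oppr_eq0 mulf_eq0 (negPf n3) subr_eq0.
Qed.

(** The nonzero finite fixed points of z^3 + a z are c and - c. *)
Lemma on_curve_param a : a != 1 -> a != 3 / 2 -> exists c,
  [/\ c != 0, 3 - 2 * a != 0 & a = 1 - c ^+ 2].
Proof.
move=> a1 a3; have [c ec] := sqrt_exists (1 - a); exists c; split.
- apply: contraNneq a1 => c0; move: ec; rewrite c0 expr0n /= => /esym/eqP.
  by rewrite subr_eq0 eq_sym.
- apply: contraNneq a3 => e; apply/eqP; apply: (mulfI n2).
  by rewrite mulrCA divff // mulr1; apply/esym/eqP; rewrite -subr_eq0 e.
by rewrite ec; ring.
Qed.

Lemma phi_cubic a b : phi (cubic_sigma a b) = cubic_class a b.
Proof.
have d1 : det2 (mat2 1 0 0 1 : 'M[k]_2) != 0.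
  by rewrite det2_mat mul0r mulr1 subr0 oner_eq0.
have poly_class (p : {poly k}) a' b' : p = 'X^3 + a'%:P * 'X + b'%:P ->
    conj_class (tofrac p) = cubic_class a' b'.
  move=> ep; rewrite -(conj_class_cubic a' b' d1); congr conj_class.
  by apply: tofrac_cubic_conj; rewrite ?oner_eq0 // ep; ring.
rewrite /phi on_curve_cubic //; have [->|b0] := eqVneq b 0; last first.
  rewrite rep_off_curve_cubic // conj_class_cubic //.
  by rewrite det2_mat mul0r mulrN1 sub0r opprK mulf_neq0.
rewrite [X in [&& X, _ & _]]sigma1_neq3 [X in [&& _, X & _]]sigma1_neq6.
rewrite [X in [&& _, _ & X]]sigma1_neq3half.
have [a1|a1] := eqVneq a 1.
  have -> : cubic_sigma a 0 = (3, 1) by rewrite a1; congr pair; ring.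
  rewrite /= (_ : (3, 1) == (6, 0) = false) ?eqxx; last first.
    by rewrite xpair_eqE oner_eq0 andbF.
  by rewrite a1; apply: poly_class; rewrite mul1r addr0.
have [a0|a0] := eqVneq a 0.
  have -> : cubic_sigma a 0 = (6, 0) by rewrite a0; congr pair; ring.
  by rewrite /= eqxx a0; apply: poly_class; rewrite mul0r !addr0.
have [a3|a3] := eqVneq a (3 / 2).
  have -> : cubic_sigma a 0 = (3 / 2, 0) by rewrite a3; congr pair; field.
  rewrite /= !xpair_eqE (_ : 3 / 2 == 6 = false); last first.
    rewrite -subr_eq0 (_ : _ - 6 = - (3 * (3 / 2))); last by field.
    by rewrite oppr_eq0 !mulf_eq0 (negPf n3) invr_eq0 (negPf n2).
  rewrite [0 == 1]eq_sym oner_eq0 andbF eqxx /= eqxx.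
  by rewrite a3; apply: poly_class; rewrite -mul_polyC addr0.
have [c [c0 a32 ea]] := on_curve_param a1 a3.
rewrite -[LHS]/(conj_class (rep_on_curve (cubic_sigma a 0))) ea.
rewrite ea in a0 a32; rewrite rep_on_curve_cubic // conj_class_cubic //.
by rewrite det2_mat mulr0 sub0r mulNr mulNr opprK !mulf_neq0.
Qed.

(** The partial fixed-point multiplier form, read on the fixed points of the
    polynomial: l consists of at least three distinct ones, and the Moebius
    map conjugating to z^3 + a z + b sends at least three multipliers, counted
    with multiplicity, to the corresponding fixed points of the polynomial. *)
Lemma partial_form_cubic A r1 r2 (l : seq (option k)) :
    let a := coef_a r1 r2 in
    det2 A != 0 ->
    uniq l -> (3 <= size l)%N -> {subset l <= cubic_fixpts r1 r2} ->
    (3 <= count (fun P => form_zero (pre_form A P) == Some (cubic_mult a P))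
       (cubic_fixpts r1 r2))%N ->
  partial_fixed_point_multiplier_form (cubic_conj A a (coef_b r1 r2)).
Proof.
move=> a dA ul sl lF c3; set f := cubic_conj _ _ _.
have pf := fixpts_cubic r1 r2 dA; right; split.
  apply: leq_trans sl _.
  rewrite -(size_map (fun P => form_zero (pre_form A P))).
  apply: uniq_leq_size.
    rewrite map_inj_uniq // => P P' /eqP e; apply/eqP; apply: contraTT e => e.
    exact: form_zero_pre_form_neq.
  move=> _ /mapP[P /lF PF ->]; rewrite mem_undup (perm_mem pf).
  by apply/mapP; exists P.
rewrite (permP pf) count_map; apply: leq_trans c3 _; apply: eq_leq.
apply: eq_in_count => P /cubic_fixpts_fixed fP.
by rewrite /= /equals_multiplier multiplier_cubic.
Qed.

Lemma partial_form_off s : ~~ on_curve s ->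
  partial_fixed_point_multiplier_form (rep_off_curve s).
Proof.
have [a [b ->]] := cubic_sigma_onto s n3; rewrite on_curve_cubic // => b0.
rewrite rep_off_curve_cubic //; move: b0.
have [r1 [r2 [-> ->]]] := cubic_fixpts_exist a b.
set a' := coef_a r1 r2; set b' := coef_b r1 r2 => b0.
have dA : det2 (off_mx a' b') != 0.
  by rewrite det2_mat mul0r mulrN1 sub0r opprK mulf_neq0.
have [r10 r20 r30] : [/\ r1 != 0, r2 != 0 & r1 + r2 != 0].
  by move: b0; rewrite /b' /coef_b !mulf_eq0 !negb_or -andbA => /and3P.
have neq_r3 (r : k) : r != 0 -> r = - (r + r) -> False.
  move=> r0 e; move/eqP: r0; apply; apply: (mulfI n3); rewrite mulr0.
  by rewrite (_ : 3 * r = r + (r + r)); [rewrite {1}e addNr|ring].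
(* As b is nonzero, r1, r2 and - (r1 + r2) are not all equal. *)
have [l [ul sl lF]] : exists l,
    [/\ uniq l, (3 <= size l)%N & {subset l <= cubic_fixpts r1 r2}].
  have [e|r12] := eqVneq r1 r2.
    exists [:: None; Some r1; Some (- (r1 + r2))]; split=> //.
      rewrite /= !inE /= andbT; apply/eqP => -[]; rewrite -e; exact: neq_r3.
    by move=> P; rewrite !inE => /or3P[]/eqP->; rewrite !eqxx ?orbT.
  exists [:: None; Some r1; Some r2]; split=> //.
    by rewrite /= !inE /= andbT.
  by move=> P; rewrite !inE => /or3P[]/eqP->; rewrite !eqxx ?orbT.
have good r : r != 0 -> fixed_by a' b' (Some r) ->
   form_zero (pre_form (off_mx a' b') (Some r))
   == Some (cubic_mult a' (Some r)).
  move=> r0 /= er; rewrite /form_zero /= !mat2E mulrN1 sub0r opprK (negPf r0).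
  apply/eqP; congr Some; apply: (mulIf r0); rewrite divfK //.
  have -> : b' = r - r ^+ 3 - a' * r by rewrite -[X in X - _ - _]er; ring.
  by ring.
apply: (partial_form_cubic dA ul sl lF).
rewrite /= !good ?oppr_eq0 ?leq_addl //.
all: by apply: cubic_fixpts_fixed; rewrite !inE !eqxx ?orbT.
Qed.

Lemma partial_form_on s : on_curve s -> s.1 != 3 -> s.1 != 6 -> s.1 != 3 / 2 ->
  partial_fixed_point_multiplier_form (rep_on_curve s).
Proof.
have [a [b ->]] := cubic_sigma_onto s n3; rewrite on_curve_cubic // => /eqP->.
rewrite [(cubic_sigma a 0).1]/= sigma1_neq3 sigma1_neq6 sigma1_neq3half.
move=> a1 a0 a3.
have [c [c0 a32 ea]] := on_curve_param a1 a3.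
rewrite ea in a0 a32 *; rewrite rep_on_curve_cubic //.
set a' := 1 - c ^+ 2 in a0 a32 *.
have dA : det2 (on_mx c) != 0.
  by rewrite det2_mat mulr0 sub0r mulNr mulNr opprK !mulf_neq0.
have ea' : a' = coef_a c 0 by rewrite /a' /coef_a; ring.
have eb' : 0 = coef_b c 0 by rewrite /coef_b; ring.
have -> : cubic_conj (on_mx c) a' 0
    = cubic_conj (on_mx c) (coef_a c 0) (coef_b c 0).
  by rewrite -ea' -eb'.
have c20 : 3 * c != 0 by rewrite mulf_neq0.
apply: (partial_form_cubic (l := [:: None; Some c; Some 0]) dA) => //.
- by rewrite /= !inE /= andbT; apply: contraNneq c0 => -[->].
- by move=> P; rewrite !inE => /or3P[]/eqP->; rewrite !eqxx ?orbT.
rewrite -ea' /= /form_zero /= !mat2E -/a' (negPf c20).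
have -> : 3 - 2 * a' - c * (3 * c) = a' by rewrite /a'; ring.
rewrite !mul0r !mulr0 !subr0 (negPf a0) (negPf a32) oppr0 mul0r eqxx.
rewrite !mulNr opprK mulfK // [a' * _]mulrC mulfK //.
rewrite (_ : Some (3 - 2 * a') == _); last first.
  by apply/eqP; congr Some; rewrite /a'; ring.
by rewrite opprK (_ : Some a' == _) //; apply/eqP; congr Some; ring.
Qed.

End Plane.

Lemma rconj1 (k : closedFieldType) (f : {fraction {poly k}}) : rconj 1%:M f = f.
Proof.
have n1 : mx_num (1%:M : 'M[k]_2) = 'X by rewrite mx_numE !mxE /= mul1r addr0.
have m1 : mx_den (1%:M : 'M[k]_2) = 1 by rewrite mx_denE !mxE /= mul0r add0r.
have e1 : mobius (1%:M : 'M[k]_2) = tofrac 'X / tofrac 1.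
  by rewrite /mobius -/(mx_num _) -/(mx_den _) n1 m1.
have d1 : det2 (1%:M : 'M[k]_2) != 0 by rewrite -unitmx2 unitmx1.
have ncX := nonconst_mobius d1; rewrite /rconj invmx1.
have -> : rcomp (mobius 1%:M) f = f.
  have [c c0 [en ed]] := rnum_rden_coprime (oner_neq0 _) (coprimep1 _) e1.
  rewrite /rcomp en ed -/(ev f _) -/(ev f _) -!mul_polyC !evM evX evC.
  have c0' : fracC k c != 0 by rewrite fmorph_eq0.
  have ev1 : ev f 1 = 1 by rewrite /ev rmorph1 hornerC.
  by rewrite ev1 mulr1 mulrC (mulKf c0').
rewrite {1}[f]tofrac_rnum_rden (rcomp_div _ ncX (rden_neq0 f)).
rewrite [RHS]tofrac_rnum_rden e1 tofrac1 divr1.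
have evT p : ev (tofrac 'X) p = tofrac p.
  have [r ->] := closed_field_poly_normal p.
  rewrite -mul_polyC evM evC ev_prod tofracM rmorph_prod; congr (_ * _).
  by apply: eq_bigr => z _; rewrite evD evN evX evC rmorphB.
by rewrite !evT.
Qed.

(** Both fields have characteristic 0. *)
Lemma is_C_or_Qbar_natr (k : closedFieldType) n :
  is_C_or_Qbar k -> n.+1%:R != 0 :> k.
Proof.
by case=> [[R [h _]]|[h _]]; rewrite -(fmorph_eq0 h) rmorph_nat pnatr_eq0.
Qed.

Theorem theorem2 (k : closedFieldType) (hk : is_C_or_Qbar k) :
  [/\ set_bij [set: k * k] (@P3 k) (@phi k),
      (forall (s : k * k) (f : {fraction {poly k}}),
         phi s = conj_class f -> (sigma f 1, sigma f 3) = s),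
      (forall f : {fraction {poly k}},
         P3 (conj_class f) -> phi (sigma f 1, sigma f 3) = conj_class f),
      (forall s : k * k, ~~ on_curve s ->
         partial_fixed_point_multiplier_form (rep_off_curve s)) &
      (forall s : k * k, on_curve s ->
         s.1 != 3 -> s.1 != 6 -> s.1 != 3 / 2 ->
         partial_fixed_point_multiplier_form (rep_on_curve s))].
Proof.
have n2 : 2 != 0 :> k := is_C_or_Qbar_natr 1 hk.
have n3 : 3 != 0 :> k := is_C_or_Qbar_natr 2 hk.
have sigma_class (f : {fraction {poly k}}) a b :
    cubic_class a b f -> (sigma f 1, sigma f 3) = cubic_sigma a b.
  by move=> [A dA ->]; apply: sigma_cubic.
have d1' : det2 (mat2 1 0 0 1 : 'M[k]_2) != 0.
  by rewrite det2_mat mul0r mulr1 subr0 oner_eq0.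
have mem_conj (f : {fraction {poly k}}) : conj_class f f.
  by exists 1%:M; rewrite ?unitmx1 ?rconj1.
have sigma_phi (s : k * k) f : phi s = conj_class f -> (sigma f 1, sigma f 3) = s.
  have [a [b ->]] := cubic_sigma_onto s n3; rewrite phi_cubic // => e.
  by apply: sigma_class; rewrite e.
have phi_sigma (f : {fraction {poly k}}) :
    P3 (conj_class f) -> phi (sigma f 1, sigma f 3) = conj_class f.
  move=> [_ [p sp <-] ep]; have [a [b eab]] := conj_class_poly n3 sp.
  have ef : conj_class f = cubic_class a b by rewrite -ep eab.
  rewrite ef (sigma_class f a b); first exact: phi_cubic.
  by rewrite -ef.
split=> //; last 2 first.
- by move=> s; apply: partial_form_off.
- by move=> s; apply: partial_form_on.
have phi_poly (a b : k) : phi (cubic_sigma a b)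
    = conj_class (tofrac ('X^3 + a%:P * 'X + b%:P)).
  rewrite phi_cubic // -(conj_class_cubic a b d1'); congr conj_class.
  by apply/esym/tofrac_cubic_conj; rewrite ?oner_eq0 //; ring.
split.
- move=> s _; have [a [b ->]] := cubic_sigma_onto s n3; rewrite phi_poly.
  exists (tofrac ('X^3 + a%:P * 'X + b%:P)) => //.
  exists ('X^3 + a%:P * 'X + b%:P) => //=.
  rewrite -addrA size_polyDl size_polyXn // ltnS.
  apply: leq_trans (size_polyD _ _) _; rewrite geq_max mul_polyC.
  rewrite (leq_trans (size_scale_leq _ _)) ?size_polyX //.
  by rewrite (leq_trans (size_polyC_leq1 _)).
- move=> s t _ _ e; have [a [b es]] := cubic_sigma_onto s n3.
  rewrite es phi_poly in e *.
  rewrite -(sigma_phi _ _ (esym e)) -es; apply/esym/sigma_phi.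
  by rewrite es phi_poly.
- move=> C PC; have [f _ ef] := PC; exists (sigma f 1, sigma f 3) => //.
  by rewrite phi_sigma // ef.
Qed.
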